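(* Let $S$ be a semigroup, and let $T$ be a subsemigroup of $S$ of finite Green index. Then the following are equivalent: (1) the semigroup $S$ is left stable; (2) the semigroup $T$ is left stable; (3) the $T$-biact ${}_TS_T$ is left stable. Likewise, the following are equivalent: (1') the semigroup $S$ is stable; (2') the semigroup $T$ is stable; (3') the $T$-biact ${}_TS_T$ is stable.
   Context: For a semigroup $S$, $S^1$ denotes the monoid obtained from $S$ by adjoining a new identity $1$, which acts as the identity on any biact. A $T$-biact is a set $A$ with a left action and a right action of the semigroup $T$ satisfying $t(t'a)=(tt')a$, $(at)t'=a(tt')$ and $(ta)t'=t(at')$. On a $T$-biact $A$ define preorders $a\leq_{\mathcal L}b\Leftrightarrow T^1a\subseteq T^1b$, $a\leq_{\mathcal R}b\Leftrightarrow aT^1\subseteq bT^1$, $a\leq_{\mathcal J}b\Leftrightarrow T^1aT^1\subseteq T^1bT^1$, with induced equivalence relations $\mathcal L,\mathcal R,\mathcal J$, and let $\mathcal H=\mathcal L\cap\mathcal R$. The biact $A$ is left stable if $ta\,\mathcal J\,a\Rightarrow ta\,\mathcal L\,a$ for all $a\in A$, $t\in T$; right stable if $at\,\mathcal J\,a\Rightarrow at\,\mathcal R\,a$ for all $a\in A$, $t\in T$; stable if it is both left and right stable. A semigroup $S$ is left stable (stable) if ${}_SS_S$ is, where ${}_SS_S$ is $S$ regarded as an $S$-biact via left and right multiplication. For a subsemigroup $T$ of $S$, ${}_TS_T$ denotes the set $S$ regarded as a $T$-biact via left and right multiplication in $S$. Each $\mathcal H$-class of ${}_TS_T$ lies entirely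 in $T$ or entirely in $S\setminus T$. The Green index of $T$ in $S$ is one more than the number of $\mathcal H$-classes of ${}_TS_T$ contained in $S\setminus T$. *)

(* Defs.v *)
From HB Require Import structures.
From mathcomp Require Import all_boot.
From mathcomp Require Import boolp classical_sets functions cardinality.

Set Implicit Arguments.
Unset Strict Implicit.
Unset Printing Implicit Defensive.

Local Open Scope classical_set_scope.
Local Open Scope group_scope.
Local Open Scope card_scope.

Record biact (T : semigroupType) := Biact {
  biact_sort :> Type;
  lact : T -> biact_sort -> biact_sort;
  ract : biact_sort -> T -> biact_sort;
  lactA : forall t t' a, lact t (lact t' a) = lact (t * t') a;
  ractA : forall t t' a, ract (ract a t) t' = ract a (t * t');
  lractA : forall t t' a, ract (lact t a) t' = lact t (ract a t')
}.

Section Green.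
Variables (T : semigroupType) (A : biact T).
Implicit Types (t : T) (u v : option T) (a b : A).

(* [option T] stands for the monoid T^1 obtained by adjoining a new identity,
   [None], even when T already has one. *)
Definition lact1 u a : A := if u is Some t then lact t a else a.
Definition ract1 a v : A := if v is Some t then ract a t else a.

Definition lorbit a : set A := [set lact1 u a | u in setT].
Definition rorbit a : set A := [set ract1 a v | v in setT].
Definition jorbit a : set A :=
  [set ract1 (lact1 u a) v | u in setT & v in setT].

Definition leL a b : Prop := lorbit a `<=` lorbit b.
Definition leR a b : Prop := rorbit a `<=` rorbit b.
Definition leJ a b : Prop := jorbit a `<=` jorbit b.

Definition eqL a b : Prop := leL a b /\ leL b a.
Definition eqR a b : Prop := leR a b /\ leR b a.
Definition eqJ a b : Prop := leJ a b /\ leJ b a.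
Definition eqH a b : Prop := eqL a b /\ eqR a b.

Definition Hclass a : set A := [set b | eqH a b].

Definition left_stable : Prop :=
  forall a t, eqJ (lact t a) a -> eqL (lact t a) a.
Definition right_stable : Prop :=
  forall a t, eqJ (ract a t) a -> eqR (ract a t) a.
Definition stable : Prop := left_stable /\ right_stable.

End Green.

Definition regular_biact (S : semigroupType) : biact S :=
  @Biact S S (fun s x => s * x) (fun x s => x * s)
    (fun s s' x => mulgA s s' x) (fun s s' x => esym (mulgA x s s'))
    (fun s s' x => esym (mulgA s x s')).

Definition semigroup_left_stable (S : semigroupType) : Prop :=
  left_stable (regular_biact S).
Definition semigroup_stable (S : semigroupType) : Prop :=
  stable (regular_biact S).

Definition subsemigroup (S : semigroupType) (T : set S) : Prop :=
  forall x y, T x -> T y -> T (x * y).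

(* The subset T as a semigroup in its own right; the closure proof is a
   parameter of the type so that the multiplication can be attached to it. *)
Definition subsemigroup_type (S : semigroupType) (T : set S)
  (_ : subsemigroup T) : Type := set_type T.

Section Subsemigroup.
Variables (S : semigroupType) (T : set S) (subT : subsemigroup T).
Local Notation U := (subsemigroup_type subT).

HB.instance Definition _ := Choice.copy U (set_type T).

Definition subsemigroup_val (t : U) : S := \val (t : set_type T).

Definition subsemigroup_mul (t t' : U) : U :=
  SigSub (mem_set (subT (set_valP t) (set_valP t'))).

Fact subsemigroup_mulA : associative subsemigroup_mul.
Proof. by move=> x y z; apply: val_inj; rewrite /= mulgA. Qed.

HB.instance Definition _ := isSemigroup.Build U subsemigroup_mulA.

Definition sub_biact : biact U :=
  @Biact U S (fun t x => subsemigroup_val t * x)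
    (fun x t => x * subsemigroup_val t)
    (fun t t' x => mulgA _ _ x) (fun t t' x => esym (mulgA x _ _))
    (fun t t' x => esym (mulgA _ x _)).

Definition outer_Hclasses : set (set S) :=
  [set C | (exists a : sub_biact, C = Hclass a) /\ C `<=` ~` T].

Definition green_index_eq (n : nat) : Prop :=
  exists2 m, outer_Hclasses #= `I_m & n = m.+1.

Definition finite_green_index : Prop := exists n, green_index_eq n.

End Subsemigroup.

(* Main.v *)
(* Passing to the monoid M = S^1 and its submonoid P = T^1, left stability of a
   biact says that a = x a v implies a \in P x a, where a = x a v can be iterated
   to a = x^n a v^n.  Finiteness of the Green index says that any long enough
   sequence outside P has two H-related terms.  It is applied to
   - s x^i, where s is provided by the left stability of S at x^n a;
   - x^i a, which lies outside P as soon as a does;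
   - x^i and v^i, to replace x and v by powers of them lying in P.
   Right stability is left stability in the opposite monoid. *)
Require Import Defs.
From HB Require Import structures.
From mathcomp Require Import all_boot.
From mathcomp Require Import boolp classical_sets functions cardinality.

Set Implicit Arguments.
Unset Strict Implicit.
Unset Printing Implicit Defensive.

Local Open Scope classical_set_scope.
Local Open Scope group_scope.

(** * Stability in a monoid relative to a submonoid *)

Section MonoidStability.
Variable M : monoidType.
Implicit Types (P A : set M) (a x v : M).

Definition submonoid P := P 1 /\ forall x y, P x -> P y -> P (x * y).

(* In [a J ta], i.e. [a = u t a v] with u, v in T^1, the factors u and t are
   merged into a single [x]: both [a = w x a] and [a = w t a] say a <=_L ta. *)
Definition left_stable_on P A := forall a x v, A a -> P x -> P v ->
  a = x * a * v -> exists2 w, P w & a = w * x * a.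

Definition right_stable_on P A := forall a x v, A a -> P x -> P v ->
  a = v * a * x -> exists2 w, P w & a = a * x * w.

Definition H_related P x y :=
  ((exists2 p, P p & x = p * y) /\ (exists2 p, P p & y = p * x)) /\
  ((exists2 p, P p & x = y * p) /\ (exists2 p, P p & y = x * p)).

(** Finite Green index stated without classes; only the first [n] values of [f] matter. *)
Definition H_pigeonhole P := exists n, forall f : nat -> M,
  (forall k, k < n -> ~ P (f k)) ->
  exists i j, [/\ i < j, j < n & H_related P (f i) (f j)].

Lemma submonoidX P x n : submonoid P -> P x -> P (x ^+ n).
Proof. by move=> [P1 PM] Px; elim: n => // n IHn; rewrite expgS; apply: PM. Qed.

(** Each further [x] on the left is absorbed by a [v] on the right. *)
Lemma sandwichX a x v i j : a = x * a * v ->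
  x ^+ (i + j) * a * v ^+ j = x ^+ i * a.
Proof.
move=> axv; elim: j => [|j IHj]; first by rewrite addn0 mulg1.
by rewrite addnS expgSr expgS -[RHS]IHj {2}axv !mulgA.
Qed.

Lemma left_stable_onS P A B : A `<=` B -> left_stable_on P B -> left_stable_on P A.
Proof. by move=> AB st a x v /AB; apply: st. Qed.

Section FiniteIndex.
Variable P : set M.
Hypotheses (smP : submonoid P) (pigP : H_pigeonhole P).

Let P1 : P 1 := smP.1.
Let PM x y : P x -> P y -> P (x * y) := @smP.2 x y.

(** Stability of $M$ yields $s$ with $s x^{n+k} a = x^k a$ for $k \le n$. If some $s x^i$ with $i <
    n$ is in $P$, then $a = (s x^i) x^{n-i} a$ suffices; otherwise two of the $s x^i$ are
    related. *)
Lemma left_stable_on_restrict_scalars :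
  left_stable_on setT setT -> left_stable_on P setT.
Proof.
move=> stM a x v _ Px Pv axv; have [n pig] := pigP.
have factor p k : P p -> 0 < k -> a = p * x ^+ k * a ->
    exists2 w, P w & a = w * x * a.
  case: k => // k Pp _ ak; exists (p * x ^+ k); last by rewrite -(mulgA p) -expgSr.
  by apply: PM => //; apply: submonoidX.
have [|s _ xns] := stM (x ^+ n * a) (x ^+ n) (v ^+ n) I I I.
  by rewrite mulgA -expgnDr sandwichX.
(* Multiply [xns] on the right by $v^{n-k}$. *)
have sx k : k <= n -> s * x ^+ (n + k) * a = x ^+ k * a.
  move=> kn; rewrite -[RHS](@sandwichX _ _ v _ (n - k)) // subnKC // xns.
  rewrite -!mulgA; congr (s * _); rewrite !mulgA -expgnDr.
  by rewrite -(sandwichX (n + k) (n - k) axv) -addnA subnKC.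
have sxn : s * x ^+ n * a = a by have := sx 0; rewrite addn0 expg0 mul1g; apply.
have [[i [lt_in Psi]]|noP] := pselect (exists i, i < n /\ P (s * x ^+ i)).
  apply: (factor _ (n - i) Psi); first by rewrite subn_gt0.
  by rewrite -(mulgA s) -expgnDr subnKC // ltnW.
have [|i [j [ij jn [[[p Pp sij] _] _]]]] := pig (fun i => s * x ^+ i).
  by move=> k kn Pk; apply: noP; exists k.
apply: (factor _ (j - i) Pp); first by rewrite subn_gt0.
(* $a = s x^i x^{n-i} a = p s x^{n+(j-i)} a = p x^{j-i} a$, the last step by [sx]. *)
rewrite -[in LHS]sxn -(subnKC (ltnW (ltn_trans ij jn))) expgnDr mulgA sij.
rewrite -!mulgA; congr (p * _); rewrite !mulgA -(mulgA s) -expgnDr.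
rewrite -sx; last by rewrite (leq_trans (leq_subr _ _)) // ltnW.
by rewrite addnBA 1?addnC ?addnBA // ltnW // (ltn_trans ij).
Qed.

(** If $a \notin P$, no $x^k a$ is in $P$, since $a = x^k a v^k$. So $x^i a = p x^j a$ with $i < j$,
    and multiplying by $v^i$ on the right gives $a = p x^{j-i} a$. *)
Lemma left_stable_on_extend : left_stable_on P P -> left_stable_on P setT.
Proof.
move=> stP a x v _ Px Pv axv; have [n pig] := pigP.
have [Pa|nPa] := pselect (P a); first exact: stP axv.
have [|i [j [ij jn [[[p Pp xij] _] _]]]] := pig (fun i => x ^+ i * a).
  move=> k _ Pk; apply: nPa; rewrite -[a]mul1g -(sandwichX 0 k axv).
  by apply: PM => //; apply: submonoidX.
exists (p * x ^+ (j - i).-1); first by apply: PM => //; apply: submonoidX.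
rewrite -(mulgA p) -expgSr prednK ?subn_gt0 // -[LHS]mul1g -(sandwichX 0 i axv).
rewrite add0n xij -(subnK (ltnW ij)) -!mulgA; congr (p * _).
by rewrite addnK mulgA sandwichX.
Qed.

(** Two related powers of $x$ give the factorisation at once. Otherwise some $x^k$ is in $P$, and on
    the right either a power of $v^k$ is in $P$ or some $q \in P$ replaces it. *)
Lemma left_stable_on_extend_scalars :
  left_stable_on P setT -> left_stable_on setT setT.
Proof.
move=> stP a x v _ _ _ axv; have [n pig] := pigP.
have factor p k : 0 < k -> a = p * x ^+ k * a ->
    exists2 w, setT w & a = w * x * a.
  by case: k => // k _ ak; exists (p * x ^+ k); rewrite // -(mulgA p) -expgSr.
have axvk k : a = x ^+ k * a * v ^+ k by rewrite (sandwichX 0) // mul1g.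
have power y : (exists2 k, 0 < k & P (y ^+ k)) \/
    exists i j, i < j /\ H_related P (y ^+ i) (y ^+ j).
  have [Py|nPy] := pselect (exists2 k, 0 < k & P (y ^+ k)); first by left.
  right; have [k _ Pk|i [j [ij _ yij]]] := pig (fun k => y ^+ k.+1).
    by apply: nPy; exists k.+1.
  by exists i.+1, j.+1.
have [[k k0 Pxk]|[i [j [ij [[[p _ xij] _] _]]]]] := power x; last first.
  apply: (factor p (j - i)); first by rewrite subn_gt0.
  rewrite {1}(axvk i) xij -{1}(subnK (ltnW ij)) -!mulgA; congr (p * _).
  by rewrite mulgA sandwichX.
have [[l l0 Pvl]|[i [j [ij [_ [_ [q Pq vij]]]]]]] := power (v ^+ k).
  have [||w _ aw] := stP a (x ^+ k ^+ l) (v ^+ k ^+ l) I _ Pvl.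
  - exact: submonoidX.
  - by rewrite -!expgnA.
  by apply: (factor w (k * l)%N); rewrite ?muln_gt0 ?k0 // expgnA.
(* With $X = x^k$ and $V = v^k$, $V^j = V^i q$ gives $a = X^j a V^i q = X^{j-i} a q$. *)
have [||w _ aw] := stP a (x ^+ k ^+ (j - i)) q I _ Pq.
- exact: submonoidX.
- have := sandwichX (j - i) i (axvk k).
  rewrite subnK 1?ltnW // => <-; rewrite -mulgA -vij.
  by rewrite -!expgnA -axvk.
apply: (factor w (k * (j - i))%N); last by rewrite expgnA.
by rewrite muln_gt0 k0 subn_gt0.
Qed.

Lemma left_stable_on_tfae :
  [<-> left_stable_on setT setT; left_stable_on P P; left_stable_on P setT].
Proof.
tfae.
- by move=> /left_stable_on_restrict_scalars; apply: left_stable_onS.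
- exact: left_stable_on_extend.
- exact: left_stable_on_extend_scalars.
Qed.

End FiniteIndex.
End MonoidStability.

(** * Right stability through the opposite monoid *)

Definition opposite (M : Type) : Type := M.

Section Opposite.
Variable M : monoidType.

Let opp_mul (x y : opposite M) : opposite M := (y : M) * (x : M).

Fact opp_mulA : associative opp_mul.
Proof. by move=> x y z; rewrite /opp_mul mulgA. Qed.

Fact opp_mul1g : left_id (1 : M) opp_mul.
Proof. exact: mulg1. Qed.

Fact opp_mulg1 : right_id (1 : M) opp_mul.
Proof. exact: mul1g. Qed.

HB.instance Definition _ := Choice.copy (opposite M) M.
HB.instance Definition _ :=
  isMonoid.Build (opposite M) opp_mulA opp_mul1g opp_mulg1.

Lemma left_stable_on_opposite (P A : set M) :
  @left_stable_on (opposite M) P A <-> right_stable_on P A.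
Proof.
have mulE (x y : opposite M) : x * y = (y : M) * (x : M) by [].
split=> st a x v Aa Px Pv.
- have := st a x v Aa Px Pv; rewrite !mulE !mulgA => {}st /st [w Pw].
  by rewrite !mulE mulgA => aw; exists w.
rewrite !mulE mulgA => /(st a x v Aa Px Pv) [w Pw aw].
by exists w; rewrite // !mulE mulgA.
Qed.

Lemma right_stable_on_tfae (P : set M) : submonoid P -> H_pigeonhole P ->
  [<-> @right_stable_on M setT setT; right_stable_on P P; right_stable_on P setT].
Proof.
move=> [P1 PM] [n pig].
have smP : @submonoid (opposite M) P by split=> // x y Px Py; apply: PM.
have pigP : @H_pigeonhole (opposite M) P.
  (* Reversing products swaps the two halves of [H_related]. *)
  by exists n => f /pig [i [j [ij jn [lij rij]]]]; exists i, j.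
have E := left_stable_on_tfae smP pigP.
tfae.
- by move=> /left_stable_on_opposite/(E 0%N 1%N)/left_stable_on_opposite.
- by move=> /left_stable_on_opposite/(E 1%N 2%N)/left_stable_on_opposite.
- by move=> /left_stable_on_opposite/(E 2%N 0%N)/left_stable_on_opposite.
Qed.

End Opposite.

(** * The monoid $S^1$ *)

(** An alias that carries the monoid structure, yet is convertible to the [option] type on which
    [lact1] and [ract1] act. *)
Definition adjoin1 (S : Type) : Type := option S.

Section Adjoin1.
Variable S : semigroupType.

Definition adjoin1_mul (x y : adjoin1 S) : adjoin1 S :=
  match x, y with
  | Some s, Some t => Some (s * t)
  | None, _ => y
  | _, None => x
  end.

Fact adjoin1_mulA : associative adjoin1_mul.
Proof. by move=> [x|] [y|] [z|] //=; rewrite mulgA. Qed.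

Fact adjoin1_mul1g : left_id None adjoin1_mul.
Proof. by case. Qed.

Fact adjoin1_mulg1 : right_id None adjoin1_mul.
Proof. by case. Qed.

HB.instance Definition _ := Choice.copy (adjoin1 S) (option S).
HB.instance Definition _ :=
  isMonoid.Build (adjoin1 S) adjoin1_mulA adjoin1_mul1g adjoin1_mulg1.

End Adjoin1.

(** * Green's preorders as divisibility *)

Section BiactPreorders.
Variables (U : semigroupType) (A : biact U).
Implicit Types (a b : A) (u v : adjoin1 U).

Lemma lact1A u v a : lact1 u (lact1 v a) = lact1 (u * v) a.
Proof. by case: u v => [u|] [v|] //=; rewrite lactA. Qed.

Lemma ract1A u v a : ract1 (ract1 a u) v = ract1 a (u * v).
Proof. by case: u v => [u|] [v|] //=; rewrite ractA. Qed.

Lemma lract1A u v a : ract1 (lact1 u a) v = lact1 u (ract1 a v).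
Proof. by case: u v => [u|] [v|] //=; rewrite lractA. Qed.

Lemma leLP a b : leL a b <-> exists u, a = lact1 u b.
Proof.
split=> [ab|[u ->]]; first by have [|u _ <-] := ab a; [exists None|exists u].
by move=> _ [w _ <-]; exists ((w : adjoin1 U) * u); rewrite ?lact1A.
Qed.

Lemma leRP a b : leR a b <-> exists u, a = ract1 b u.
Proof.
split=> [ab|[u ->]]; first by have [|u _ <-] := ab a; [exists None|exists u].
by move=> _ [w _ <-]; exists (u * (w : adjoin1 U)); rewrite ?ract1A.
Qed.

Lemma leJP a b : leJ a b <-> exists u v, a = ract1 (lact1 u b) v.
Proof.
split=> [ab|[u [v ->]]].
  have [|u _ [v _ <-]] := ab a; first by exists None => //; exists None.
  by exists u, v.
move=> _ [w _ [z _ <-]].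
exists ((w : adjoin1 U) * u) => //; exists (v * (z : adjoin1 U)) => //.
by rewrite -ract1A -lact1A [in RHS]lract1A ract1A -!lract1A ract1A.
Qed.

End BiactPreorders.

(** * Stability of a biact read off in $S^1$ *)

Section Embedding.
Variables (U S : semigroupType) (A : biact U) (i : U -> S) (j : A -> S).
Hypotheses (iM : {morph i : x y / x * y}) (j_inj : injective j).
Hypotheses (jl : forall t a, j (lact t a) = i t * j a)
           (jr : forall a t, j (ract a t) = j a * i t).

Let P : set (adjoin1 S) := range (omap i).
(** Contains the adjoined 1 besides the image of [A], so that [B] can be all of $S^1$ or equal to
    [P]. *)
Let B : set (adjoin1 S) := range (omap j).
Let i1 (u : adjoin1 U) : adjoin1 S := omap i u.
Let j1 (a : A) : adjoin1 S := Some (j a).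

Let i1M u v : i1 (u * v) = i1 u * i1 v.
Proof. by case: u v => [u|] [v|] //=; rewrite /i1 /= iM. Qed.

Let jl1 u a : j1 (lact1 u a) = i1 u * j1 a.
Proof. by case: u => //= t; rewrite /j1 jl. Qed.

Let jr1 a v : j1 (ract1 a v) = j1 a * i1 v.
Proof. by case: v => //= t; rewrite /j1 jr. Qed.

Let j1_inj : injective j1.
Proof. by move=> a b [] /j_inj. Qed.

Let i1_in u : P (i1 u).
Proof. by exists u. Qed.

Let j1_in a : B (j1 a).
Proof. by exists (Some a). Qed.

Let mul1_eq1 (x v : adjoin1 S) : 1 = x * v -> x = 1 /\ v = 1.
Proof. by case: x v => [x|] [v|]. Qed.

(** At the adjoined 1 stability is automatic, as $1 = xv$ forces $x = v = 1$. Elsewhere $a = tav$ is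
    an instance of $a \leq_{\mathcal J} ta$. *)
Lemma left_stable_embedding : left_stable A <-> left_stable_on P B.
Proof.
split=> st.
  move=> a x v [[a0|] _ <-] [u _ <-] [v0 _ <-]; last first.
    rewrite mulg1 => /mul1_eq1 [-> _].
    by exists 1; [exact: (i1_in None)|rewrite !mul1g].
  rewrite -[omap j _]/(j1 a0) -[omap i u]/(i1 u) -[omap i v0]/(i1 v0).
  case: u => [t|] axv; last first.
    by exists 1; [exact: (i1_in None)|rewrite !mul1g].
  have [|_ /leLP[w aw]] := st a0 t.
    split; apply/leJP; first by exists (Some t), None.
    by exists None, v0; apply: j1_inj; rewrite jr1 (jl1 (Some t)).
  by exists (i1 w) => //; rewrite {1}aw jl1 (jl1 (Some t)) mulgA.
move=> a t [_ /leJP [u [v E]]].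
split; apply/leLP; first by exists (Some t).
(* In $a = u(ta)v$ the product $ut$ serves as [x]; the resulting $w$ satisfies $a = (wu)(ta)$. *)
have [||||_ [w _ <-] aw] := st (j1 a) (i1 (u * (Some t : adjoin1 U))) (i1 v) => //.
  by rewrite -jl1 -jr1 -lact1A {1}E.
exists ((w : adjoin1 U) * u); apply: j1_inj.
rewrite -[lact t a]/(lact1 (Some t) a) !jl1 -[omap i w]/(i1 w) in aw *.
by rewrite {1}aw !i1M !mulgA.
Qed.

Lemma right_stable_embedding : right_stable A <-> right_stable_on P B.
Proof.
split=> st.
  move=> a x v [[a0|] _ <-] [u _ <-] [v0 _ <-]; last first.
    rewrite mulg1 => /mul1_eq1 [_ ->].
    by exists 1; [exact: (i1_in None)|rewrite !mulg1].
  rewrite -[omap j _]/(j1 a0) -[omap i u]/(i1 u) -[omap i v0]/(i1 v0).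
  case: u => [t|] axv; last first.
    by exists 1; [exact: (i1_in None)|rewrite !mulg1].
  have [|_ /leRP[w aw]] := st a0 t.
    split; apply/leJP; first by exists None, (Some t).
    exists v0, None; apply: j1_inj.
    by rewrite jr1 jl1 (jr1 _ (Some t)) mulg1 mulgA.
  by exists (i1 w) => //; rewrite {1}aw jr1 (jr1 _ (Some t)).
move=> a t [_ /leJP [u [v E]]].
split; apply/leRP; first by exists (Some t).
have [||||_ [w _ <-] aw] := st (j1 a) (i1 ((Some t : adjoin1 U) * v)) (i1 u) => //.
  by rewrite -jl1 -jr1 lract1A -ract1A -lract1A {1}E.
exists (v * (w : adjoin1 U)); apply: j1_inj.
rewrite -[ract a t]/(ract1 a (Some t)) !jr1 -[omap i w]/(i1 w) in aw *.
by rewrite {1}aw !i1M !mulgA.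
Qed.

End Embedding.

(** * Subsemigroups of finite Green index *)

Section Subsemigroup.
Variables (S : semigroupType) (T : set S) (subT : subsemigroup T).
Local Notation U := (subsemigroup_type subT).
Local Notation val1 := (omap (@subsemigroup_val S T subT)).

Let T1 : set (adjoin1 S) := range val1.

Lemma subsemigroup_val_inj : injective (@subsemigroup_val S T subT).
Proof. exact: val_inj. Qed.

Lemma range_omap_val (x : adjoin1 S) :
  T1 x <-> if x is Some s then T s else True.
Proof.
split; first by move=> [[t|] _ <-] //=; exact: set_valP.
case: x => [s Ts|_]; last by exists None.
by exists (Some (SigSub (mem_set Ts) : U)).
Qed.

Lemma submonoid_adjoin1 : submonoid T1.
Proof.
split; first by exists None.
move=> [x|] [y|] /range_omap_val Tx /range_omap_val Ty; apply/range_omap_val => //.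
exact: subT.
Qed.

Lemma eqH_adjoin1 (a b : sub_biact subT) : eqH a b ->
  H_related T1 (Some (a : S) : adjoin1 S) (Some (b : S) : adjoin1 S).
Proof.
have L (x y : sub_biact subT) : leL x y ->
    exists2 p, T1 p & (Some (x : S) : adjoin1 S) = p * Some (y : S).
  by move=> /leLP[u ->]; exists (val1 u); [exists u|case: u].
have R (x y : sub_biact subT) : leR x y ->
    exists2 p, T1 p & (Some (x : S) : adjoin1 S) = (Some (y : S) : adjoin1 S) * p.
  by move=> /leRP[u ->]; exists (val1 u); [exists u|case: u].
by move=> [[/L ? /L ?] [/R ? /R ?]].
Qed.

Lemma Hclass_outer (a : sub_biact subT) : ~ T a -> Hclass a `<=` ~` T.
Proof.
move=> nTa b [[/leLP[u ab] _] _] Tb; apply: nTa; rewrite ab.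
by case: u {ab} => //= t; apply: subT => //; exact: set_valP.
Qed.

Lemma eqH_refl (a : sub_biact subT) : eqH a a.
Proof. by split; split. Qed.

(** With $m$ classes outside $T$, two of any $m+1$ elements outside $T$ share a class. The bound is
    the Green index itself. *)
Lemma finite_green_index_pigeonhole : finite_green_index subT -> H_pigeonhole T1.
Proof.
move=> [_ [m /card_eqPle[/pcard_leP[g] _] _]]; exists m.+1 => f nTf.
have [h fh] : exists h : nat -> S, forall k, k < m.+1 -> f k = Some (h k) /\ ~ T (h k).
  (* A default for indices beyond [m], where [f] may be 1; [f 0], which is not 1, supplies it. *)
  have [s0 _] : exists s0 : S, True.
    have := nTf 0%N isT; case: (f 0%N) => [s|] nT0; first by exists s.
    by case: nT0; apply/range_omap_val.
  exists (fun k => odflt s0 (f k)) => k /nTf; case: (f k) => [s|] nTs /=.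
    by split=> // Ts; apply/nTs/range_omap_val.
  by case: nTs; apply/range_omap_val.
pose c k : set S := Hclass (h k : sub_biact subT).
have outer k : k < m.+1 -> c k \in outer_Hclasses subT.
  by move=> /fh[_ nT]; rewrite inE; split; [exists (h k)|exact: Hclass_outer].
have gm k : k < m.+1 -> g (c k) < m.
  by move=> /outer; rewrite inE => /(@funS _ _ _ _ g).
pose G (k : 'I_m.+1) : 'I_m := Ordinal (gm k (ltn_ord k)).
have /injectivePn[k [l nkl /(congr1 val) /= gkl]] : ~~ injectiveb G.
  by apply/negP => /injectiveP /leq_card; rewrite !card_ord ltnn.
have ckl : c k = c l by apply: (@inj _ _ _ g) gkl; exact: outer.
(* Both directions are derived, as [k] and [l] come unordered. *)
have Hkl : eqH (h k : sub_biact subT) (h l).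
  by have := eqH_refl (h l); rewrite -[eqH _ _]/(c l (h l)) -ckl.
have Hlk : eqH (h l : sub_biact subT) (h k).
  by have := eqH_refl (h k); rewrite -[eqH _ _]/(c k (h k)) ckl.
have [fk _] := fh k (ltn_ord k); have [fl _] := fh l (ltn_ord l).
case: (ltngtP k l) => [kl|lk|/val_inj kl]; last by rewrite kl eqxx in nkl.
  by exists k, l; split; rewrite // fk fl; exact: eqH_adjoin1.
by exists l, k; split; rewrite // fk fl; exact: eqH_adjoin1.
Qed.

End Subsemigroup.

(** * The equivalences for $S$, $T$ and ${}_TS_T$ *)

Theorem theorem5p4 (S : semigroupType) (T : set S) (subT : subsemigroup T)
    (finT : finite_green_index subT) :
  [<-> semigroup_left_stable S;
       semigroup_left_stable (subsemigroup_type subT);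
       left_stable (sub_biact subT)]
  /\
  [<-> semigroup_stable S;
       semigroup_stable (subsemigroup_type subT);
       stable (sub_biact subT)].
Proof.
have smT := submonoid_adjoin1 subT.
have pigT := finite_green_index_pigeonhole finT.
have EL := left_stable_on_tfae smT pigT.
have ER := right_stable_on_tfae smT pigT.
(* For the identity embedding of $S$, $P = B = S^1$. *)
have idT : range (omap (@id S)) = [set: adjoin1 S].
  by apply/seteqP; split=> // x _; exists x; rewrite // omap_id.
have LS : semigroup_left_stable S <-> @left_stable_on (adjoin1 S) setT setT.
  by rewrite -idT; apply: left_stable_embedding.
have RS : right_stable (regular_biact S) <-> @right_stable_on (adjoin1 S) setT setT.
  by rewrite -idT; apply: right_stable_embedding.
(* Here $T$ is both scalars and carrier: $P = B = T^1$. *)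
have LT := @left_stable_embedding _ S (regular_biact (subsemigroup_type subT)) _ _
  (fun _ _ => erefl) (@subsemigroup_val_inj _ _ subT)
  (fun _ _ => erefl) (fun _ _ => erefl).
have RT := @right_stable_embedding _ S (regular_biact (subsemigroup_type subT)) _ _
  (fun _ _ => erefl) (@subsemigroup_val_inj _ _ subT)
  (fun _ _ => erefl) (fun _ _ => erefl).
(* Scalars $T$, carrier $S$: $P = T^1$, and [idT] turns $B$ into $S^1$. *)
have LB : left_stable (sub_biact subT) <-> left_stable_on _ _ :=
  @left_stable_embedding _ S (sub_biact subT) _ id
    (fun _ _ => erefl) (@inj_id _) (fun _ _ => erefl) (fun _ _ => erefl).
have RB : right_stable (sub_biact subT) <-> right_stable_on _ _ :=
  @right_stable_embedding _ S (sub_biact subT) _ id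
    (fun _ _ => erefl) (@inj_id _) (fun _ _ => erefl) (fun _ _ => erefl).
rewrite idT in LB RB.
split; tfae.
- by move=> /LS/(EL 0%N 1%N)/LT.
- by move=> /LT/(EL 1%N 2)/LB.
- by move=> /LB/(EL 2 0%N)/LS.
- by move=> [/LS/(EL 0%N 1%N)/LT ? /RS/(ER 0%N 1%N)/RT ?].
- by move=> [/LT/(EL 1%N 2)/LB ? /RT/(ER 1%N 2)/RB ?].
- by move=> [/LB/(EL 2 0%N)/LS ? /RB/(ER 2 0%N)/RS ?].
Qed.
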